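(* Let $X$ be a nonempty compact metric space, let $F$ be a compact iterated function system on $X$ with attractor $W\subset X$, and let $\nu$ be a regular Borel probability measure on the compact space $F$. Let $r:=\sup\{r_f\mid f\in F\}<1$, where $r_f$ is the Lipschitz constant of $f$. Then the $\nu$-averaging mapping $$\mathcal{A}_\nu:\ \mathcal{P}(W)\to\mathcal{P}(W),\qquad \mu\mapsto\int_F (f.\mu)\,\mathrm{d}\nu(f),$$ is a contraction relative to the metric $L$ on $\mathcal{P}(W)$, with contraction constant at most $r$. In particular, there is a unique measure $\rho^{(\nu)}\in\mathcal{P}(W)$ which satisfies $$\rho^{(\nu)}=\int_F (f.\rho^{(\nu)})\,\mathrm{d}\nu(f).$$
   Context: A compact iterated function system (compact IFS) on a metric space $X$ is a nonempty subset $F$ of $C(X,X)$ which is compact in the compact-open topology, consists of Lipschitz mappings, and for which there is a uniform bound $r'<1$ with $r_f\le r'$ for all $f\in F$. Its attractor is the unique nonempty compact set $W\subset X$ with $W=\bigcup_{f\in F}f(W)$; in particular $f(W)\subset W$ for all $f\in F$. $\mathcal{P}(W)$ is the set of regular Borel probability measures on $W$; for a measure $\mu$ and a function $\phi$ write $\mu(\phi)=\int\phi\,\mathrm{d}\mu$. For $f\in F$ and $\mu\in\mathcal{P}(W)$, $f.\mu$ is the push-forward, $(f.\mu)(\phi)=\mu(\phi\circ f)$ for $\phi\in C(W,\mathbb{R})$. The measure $\int_F(f.\mu)\,\mathrm{d}\nu(f)$ is defined by $\phi\mapsto\int_F\mu(\phi\circ f)\,\mathrm{d}\nu(f)$ for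 $\phi\in C(W,\mathbb{R})$. The metric $L$ on $\mathcal{P}(W)$ is $L(\mu,\mu')=\sup\{|\mu(\phi)-\mu'(\phi)| : \phi:W\to\mathbb{R}\text{ Lipschitz with Lipschitz constant}\le 1\}$. *)

(* Defs.v *)
From HB Require Import structures.
From mathcomp Require Import all_boot all_order all_algebra.
From mathcomp Require Import all_classical all_reals all_analysis.
From mathcomp Require Import giry.

Set Implicit Arguments.
Unset Strict Implicit.
Unset Printing Implicit Defensive.

Import Order.TTheory GRing.Theory Num.Theory.
Import numFieldNormedType.Exports.
(* gives [continuousType U V] the compact-open topology *)
Export ArrowAsCompactOpen.

Local Open Scope classical_set_scope.
Local Open Scope ring_scope.

Section Lipschitz.
Context {R : realType} {A B : Type}.
(* The distances are explicit arguments: they will be [mdist] on a metric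
   space, its restriction to a subset, or a distance between measures. *)
Variables (dA : A -> A -> R) (dB : B -> B -> R).

Definition lipschitz_bounds (f : A -> B) : set R :=
  [set k | 0 <= k /\ forall x y, dB (f x) (f y) <= k * dA x y].

Definition is_lipschitz (f : A -> B) : Prop := lipschitz_bounds f !=set0.

(* the least admissible constant; only meaningful if [is_lipschitz f] *)
Definition lipschitz_const (f : A -> B) : R := inf (lipschitz_bounds f).

End Lipschitz.

Definition is_contractive {R : realType} {A : Type} (d : A -> A -> R)
    (f : A -> A) : Prop :=
  is_lipschitz d d f /\ lipschitz_const d d f < 1.

Section IFS.
Context {R : realType} {X : metricType R}.
Implicit Types (F : set (continuousType X X)) (W : set X).

Definition compact_IFS F : Prop :=
  [/\ F !=set0, compact F,
      forall f : continuousType X X, F f -> is_lipschitz mdist mdist f &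
      exists2 r' : R, r' < 1 & forall f : continuousType X X,
        F f -> lipschitz_const mdist mdist f <= r'].

Definition is_attractor F W : Prop :=
  [/\ W !=set0, compact W & W = \bigcup_(f in F) (f @` W)].

Lemma compact_IFS_neq0 F : compact_IFS F -> F !=set0.
Proof. by case. Qed.

Lemma attractor_neq0 F W : is_attractor F W -> W !=set0.
Proof. by case. Qed.

Lemma attractor_stable F W : is_attractor F W ->
  forall (f : F) (w : W), val f (val w) \in W.
Proof.
case=> _ _ WE f w; apply/mem_set.
suff: (\bigcup_(g in F) (g @` W)) (val f (val w)) by rewrite -WE.
by exists (val f); [exact: set_valP | exists (val w) => //; exact: set_valP].
Qed.

(* the map W -> W induced by a member of F *)
Definition attractor_map F W (hW : is_attractor F W) (f : F) (w : W) : W :=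
  SigSub (attractor_stable hW f w).

End IFS.

(* A nonempty subset as a topological space. The library's measurable spaces
   must have a distinguished point; which one is chosen is irrelevant. *)
Definition subspace_type {T : topologicalType} (A : set T) (A0 : A !=set0) :
  Type := A.

HB.instance Definition _ (T : topologicalType) (A : set T) (A0 : A !=set0) :=
  Topological.copy (subspace_type A0) (set_type A).
HB.instance Definition _ (T : topologicalType) (A : set T) (A0 : A !=set0) :=
  isPointed.Build (subspace_type A0) (SigSub (mem_set (projT2 (cid A0)))).

(* [T] with its Borel sigma-algebra *)
Definition borel (T : ptopologicalType) := g_sigma_algebraType (@open T).

Definition regular_measure {R : realType} {T : ptopologicalType}
    (mu : set T -> \bar R) : Prop :=
  forall A : set (borel T), measurable A ->
    mu A = ereal_inf [set mu U | U in [set U : set T | open U /\ A `<=` U]] /\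
    mu A = ereal_sup [set mu K | K in [set K : set T | compact K /\ K `<=` A]].

(* Elements are set functions defined on all subsets, of which only the values
   on Borel sets matter: two of them represent the same measure when they are
   related by [measure_eq], which is weaker than Leibniz equality. *)
Record regular_probability (R : realType) (T : ptopologicalType) := RegProb {
  prob_of :> probability (borel T) R ;
  prob_regular : regular_measure prob_of }.

HB.instance Definition _ (R : realType) (T : ptopologicalType) :=
  gen_eqMixin (regular_probability R T).
HB.instance Definition _ (R : realType) (T : ptopologicalType) :=
  gen_choiceMixin (regular_probability R T).

(* P(A) for a nonempty subset A of a topological space *)
Definition prob_on (R : realType) (T : topologicalType) (A : set T)
  (A0 : A !=set0) := regular_probability R (subspace_type A0).

Section MeasureDistance.
Context {R : realType} {X : metricType R} {W : set X} {W0 : W !=set0}.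

Definition mdist_on (x y : W) : R := mdist (val x) (val y).

Definition lip1 : set (W -> R) :=
  [set phi | is_lipschitz mdist_on (fun s t : R => `|s - t|) phi /\
    lipschitz_const mdist_on (fun s t : R => `|s - t|) phi <= 1].

(* the metric L *)
Definition Ldist (mu mu' : prob_on R W0) : R :=
  sup [set `|\int[mu]_w phi w - \int[mu']_w phi w| | phi in lip1].

End MeasureDistance.

Section Averaging.
Context {R : realType} {X : metricType R}.
Context {F : set (continuousType X X)} {W : set X}.
Variables (hF : compact_IFS F) (hW : is_attractor F W).
Variable nu : prob_on R (compact_IFS_neq0 hF).
Implicit Types mu m : prob_on R (attractor_neq0 hW).

(* [m] represents the functional [phi |-> \int_F mu(phi o f) dnu(f)] on C(W,R) *)
Definition is_average mu m : Prop :=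
  forall phi : W -> R, continuous phi ->
    \int[m]_w phi w = \int[nu]_f (\int[mu]_w phi (attractor_map hW f w)).

(* The measure representing that functional, chosen by description;
   the default value [mu] is used only if there is none. *)
Definition averaging mu : prob_on R (attractor_neq0 hW) :=
  xget mu [set m | is_average mu m].

End Averaging.

(* Main.v *)
(* On the compact space [W], a positive normalized linear functional on the
   continuous functions is integration against a regular Borel probability
   measure (Riesz); applied to [phi |-> \int_F mu(phi o f) dnu(f)] this gives
   the averaged measure. If [phi] is 1-Lipschitz then [phi o f] is r-Lipschitz,
   so averaging contracts [L] by [r]. The set P(W) is weakly compact: the limits
   of [\int phi dmu_n] along an ultrafilter form a functional to which Riesz
   applies again. Such a limit of the iterates of the averaging map is a fixed
   point up to [L]-distance 0, and [L]-distance 0 means equality on Borel sets,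
   because indicators of open sets are monotone limits of Lipschitz functions. *)
From HB Require Import structures.
Require Import Defs.
From mathcomp Require Import all_boot all_order all_algebra.
From mathcomp Require Import all_classical all_reals all_analysis.
From mathcomp Require Import giry measurable_realfun.
From mathcomp Require Import lra.
Import Order.TTheory GRing.Theory Num.Theory.
Import numFieldNormedType.Exports.
Local Open Scope classical_set_scope.
Local Open Scope ring_scope.

Set Implicit Arguments.
Unset Strict Implicit.
Unset Printing Implicit Defensive.

(** The distance is a bare function compatible with the topology, because [subspace_type] is given a
    topology but no metric structure. *)
Record metrizes {R : realType} {T : topologicalType} (d : T -> T -> R) : Prop :=
  Metrizes {
  metrizesxx : forall x, d x x = 0 ;
  metrizes_sym : forall x y, d x y = d y x ;
  metrizes_triangle : forall x y z, d x z <= d x y + d y z ;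
  metrizes_nbhs : forall x (U : set T),
    nbhs x U <-> exists2 e, 0 < e & forall y, d x y < e -> U y }.

(** * Lipschitz cutoffs of open sets *)

Section distances.
Context {R : realType} {T : topologicalType} {d : T -> T -> R}.
Hypothesis dP : metrizes d.

Lemma metrizes_ge0 x y : 0 <= d x y.
Proof.
have := metrizes_triangle dP x y x; rewrite metrizesxx// (metrizes_sym dP y x).
by move=> ?; lra.
Qed.

Lemma lipschitz_continuous (k : R) (f : T -> R) :
  (forall x y, `|f x - f y| <= k * d x y) -> continuous f.
Proof.
move=> kf x; apply/cvgrPdist_lt => e e0; apply/(metrizes_nbhs dP).
exists (e / (`|k| + 1)) => [|y]; first by rewrite divr_gt0// ltr_wpDl.
rewrite ltr_pdivlMr ?ltr_wpDl// => h; apply: le_lt_trans (kf x y) _.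
apply: le_lt_trans h; rewrite mulrC ler_wpM2l ?metrizes_ge0//.
by rewrite (le_trans (ler_norm k))// lerDl.
Qed.

(** The distance to the complement of [U], capped at 1. The inserted 1 keeps the infimum meaningful
    when [U] is the whole space. *)
Definition codist (U : set T) (x : T) : R :=
  inf (1 |` [set d x y | y in ~` U]).

Let codist_lb (U : set T) x : has_lbound (1 |` [set d x y | y in ~` U]).
Proof. by exists 0 => _ /= [->|[y _ <-]]; rewrite ?metrizes_ge0. Qed.

Lemma codist_ge0 U x : 0 <= codist U x.
Proof.
apply: lb_le_inf; first by exists 1; left.
by move=> _ /= [->|[y _ <-]]; rewrite ?metrizes_ge0.
Qed.

Lemma codist_out (U : set T) x : ~ U x -> codist U x = 0.
Proof.
move=> Ux; apply/eqP; rewrite eq_le codist_ge0 andbT.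
by apply: ge_inf => //; right; exists x => //; rewrite metrizesxx.
Qed.

Lemma codist_lipschitz U x y : codist U x <= codist U y + d x y.
Proof.
rewrite -lerBlDr; apply: lb_le_inf; first by exists 1; left.
move=> _ /= [->|[z Uz <-]].
  by rewrite lerBlDr (@le_trans _ _ 1) ?lerDl ?metrizes_ge0// ge_inf//; left.
rewrite lerBlDr addrC; apply: le_trans (metrizes_triangle dP x y z).
by apply: ge_inf => //; right; exists z.
Qed.

Lemma codist_gt0 U x : open U -> U x -> 0 < codist U x.
Proof.
move=> oU Ux; have /(metrizes_nbhs dP)[e e0 eU] : nbhs x U.
  exact: open_nbhs_nbhs.
apply: (@lt_le_trans _ _ (Num.min 1 e)); first by rewrite lt_min ltr01.
apply: lb_le_inf; first by exists 1; left.
move=> _ /= [->|[z Uz <-]]; rewrite ge_min ?lexx//.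
by apply/orP; right; rewrite leNgt; apply/negP => /eU.
Qed.

(** For open [U] these [m]-Lipschitz functions increase to the indicator of [U], and so link
    Lipschitz test functions to measures of open sets. *)
Definition cutoff (U : set T) (m : nat) (x : T) : R :=
  Num.min 1 (m%:R * codist U x).

Lemma cutoff_ge0 U m x : 0 <= cutoff U m x.
Proof. by rewrite le_min ler01 mulr_ge0// codist_ge0. Qed.

Lemma cutoff_le1 U m x : cutoff U m x <= 1.
Proof. by rewrite ge_min lexx. Qed.

Lemma cutoff_out (U : set T) m x : ~ U x -> cutoff U m x = 0.
Proof.
by move=> Ux; rewrite /cutoff codist_out// mulr0; apply/min_idPr.
Qed.

Lemma cutoff_lipschitz U m x y : `|cutoff U m x - cutoff U m y| <= m%:R * d x y.
Proof.
wlog : x y / cutoff U m y <= cutoff U m x => [hw|yx].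
  have [/hw//|/ltW/hw] := leP (cutoff U m y) (cutoff U m x).
  by rewrite distrC (metrizes_sym dP).
rewrite ger0_norm ?subr_ge0// lerBlDl /cutoff.
have := codist_lipschitz U x y; have := metrizes_ge0 x y.
move: (codist U x) (codist U y) (d x y) => a b c c0 abc.
have mc0 : 0 <= m%:R * c by rewrite mulr_ge0.
have : m%:R * a <= m%:R * b + m%:R * c by rewrite -mulrDr ler_wpM2l.
by have [h1|h1] := leP 1 (m%:R * a); have [h2|h2] := leP 1 (m%:R * b); lra.
Qed.

Lemma cutoff_nondecreasing U m n x : (m <= n)%N ->
  cutoff U m x <= cutoff U n x.
Proof.
move=> mn; rewrite /cutoff le_min ge_min lexx/= ge_min.
by apply/orP; right; rewrite ler_wpM2r ?codist_ge0// ler_nat.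
Qed.

Lemma cutoff_continuous U m : continuous (cutoff U m).
Proof. exact/lipschitz_continuous/cutoff_lipschitz. Qed.

Lemma cutoff_near1 U x : open U -> U x -> \forall m \near \oo, cutoff U m x = 1.
Proof.
move=> oU Ux; have g0 := codist_gt0 oU Ux.
near=> m; apply/min_idPl; rewrite -ler_pdivrMr//.
near: m; exact: nbhs_infty_ger.
Unshelve. all: by end_near. Qed.

End distances.
Arguments codist {R T} d U x.
Arguments cutoff {R T} d U m x.

(** * Integration of continuous functions on a compact space *)

Section continuous_sum.
Context {R : realType} {T : topologicalType}.

Lemma continuous_sumr n (h : nat -> T -> R) : (forall i, continuous (h i)) ->
  continuous (fun x => \sum_(i < n) h i x).
Proof.
move=> ch; elim: n => [|n ih] x.
  by under eq_fun do rewrite big_ord0; exact: cvg_cst.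
under eq_fun do rewrite big_ord_recr/=.
by apply: cvgD; [exact: ih|exact: ch].
Qed.

(** Stated for an abstract functional because [I_slices] needs it both for the Riesz functional and
    for the integral. *)
Lemma additive_sumr (L : (T -> R) -> R) n (h : nat -> T -> R) :
  (forall f g : T -> R, continuous f -> continuous g ->
    L (fun x => f x + g x) = L f + L g) ->
  L (fun=> 0) = 0 -> (forall i, continuous (h i)) ->
  L (fun x => \sum_(i < n) h i x) = \sum_(i < n) L (h i).
Proof.
move=> LD L0 ch; elim: n => [|n ih].
  by rewrite big_ord0 -[RHS]L0; congr L; apply/funext => x; rewrite big_ord0.
rewrite big_ord_recr/= -ih -LD//; last exact: continuous_sumr.
by congr L; apply/funext => x; rewrite big_ord_recr.
Qed.

End continuous_sum.

Section continuous_borel.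
Context {R : realType} {T : ptopologicalType}.
Implicit Types (f g : T -> R) (mu : probability (borel T) R).

Lemma continuous_measurable_borel f : continuous f ->
  measurable_fun [set: borel T] (f : borel T -> R).
Proof.
move=> /continuousP cf; apply: (measurability _ (RGenOpens.measurableE R)).
move=> _ [_ [a [b ->] <-]]; rewrite setTI.
by apply: sub_sigma_algebra; apply: cf; exact: interval_open.
Qed.

Lemma continuous_bounded_integrable mu f (k : R) : continuous f ->
  (forall x, `|f x| <= k) ->
  mu.-integrable [set: borel T] (EFin \o f).
Proof.
move=> cf kf; apply: measurable_bounded_integrable => //.
- by rewrite -ge0_fin_numE ?fin_num_measure.
- exact: continuous_measurable_borel.
- exists k; split; first exact: num_real.
  by move=> y ky z _; exact: le_trans (kf z) (ltW ky).
Qed.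

Lemma compact_bounded_fun f : compact [set: T] -> continuous f ->
  exists k, forall x, `|f x| <= k.
Proof.
move=> cT cf; have /compact_bounded[k [_ kf]] : compact (f @` [set: T]).
  by apply: continuous_compact => //; exact: continuous_subspaceT.
by exists (k + 1) => x; apply: (kf (k + 1)); [rewrite ltrDl|exists x].
Qed.

Lemma continuous_integrable mu f : compact [set: T] -> continuous f ->
  mu.-integrable [set: borel T] (EFin \o f).
Proof.
by move=> cT cf; have [k] := compact_bounded_fun cT cf;
  exact: continuous_bounded_integrable.
Qed.

End continuous_borel.

Section continuous_Rintegral.
Context {R : realType} {T : ptopologicalType}.
Hypothesis cT : compact [set: T].
Implicit Types (f g : T -> R) (mu : probability (borel T) R).

Lemma continuous_RintegralD mu f g : continuous f -> continuous g ->
  \int[mu]_x (f x + g x) = \int[mu]_x f x + \int[mu]_x g x.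
Proof.
by move=> cf cg; apply: RintegralD => //; exact: continuous_integrable.
Qed.

Lemma continuous_RintegralZ mu (c : R) f : continuous f ->
  \int[mu]_x (c * f x) = c * \int[mu]_x f x.
Proof.
by move=> cf; apply: RintegralZl => //; exact: continuous_integrable.
Qed.

Lemma continuous_RintegralB mu f g : continuous f -> continuous g ->
  \int[mu]_x (f x - g x) = \int[mu]_x f x - \int[mu]_x g x.
Proof.
by move=> cf cg; apply: RintegralB => //; exact: continuous_integrable.
Qed.

Lemma le_continuous_Rintegral mu f g : continuous f -> continuous g ->
  (forall x, f x <= g x) -> \int[mu]_x f x <= \int[mu]_x g x.
Proof.
by move=> cf cg fg; apply: le_Rintegral => //; exact: continuous_integrable.
Qed.

Lemma probability_Rintegral_cst mu (c : R) : \int[mu]_x c = c.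
Proof.
transitivity (c * fine (mu setT)); first exact: Rintegral_cst.
by rewrite probability_setT mulr1.
Qed.

Lemma le_norm_continuous_Rintegral mu f (k : R) : continuous f ->
  (forall x, `|f x| <= k) -> `|\int[mu]_x f x| <= k.
Proof.
move=> cf fk; have ck (c : R) : continuous (fun _ : T => c).
  by move=> x; exact: cvg_cst.
rewrite ler_norml -{1}(probability_Rintegral_cst mu (- k)).
rewrite -{2}(probability_Rintegral_cst mu k).
have fkx x : - k <= f x <= k by rewrite -ler_norml.
by apply/andP; split; apply: le_continuous_Rintegral => [||x];
  try exact: ck; by [|have /andP[] := fkx x].
Qed.

End continuous_Rintegral.

(** * Riesz representation on a compact metrizable space *)

Definition bumps {R : realType} {T : topologicalType} (U : set T) :
    set (T -> R) :=
  [set f : T -> R | [/\ continuous f, forall x, 0 <= f x <= 1 &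
    forall x, ~ U x -> f x = 0]].

(** In [I_slices], [t] is a value of the function, [a] a level, and [b] the common thickness of the
    slices. *)
Lemma slice_bounds {R : realFieldType} (t a b : R) : 0 <= b ->
  let s := Num.min t (a + b) - Num.min t a in
  [/\ 0 <= s <= b, t <= a -> s = 0 & a + b <= t -> s = b].
Proof.
move=> b0 s; rewrite /s.
by have [h1|h1] := leP t (a + b); have [h2|h2] := leP t a;
  split; try move=> h3; lra.
Qed.

Section riesz.
Context {R : realType} {T : ptopologicalType} {d : T -> T -> R}.
Hypotheses (dP : metrizes d) (cT : compact [set: T]).
Variable L : (T -> R) -> R.
Hypothesis LD : forall f g : T -> R, continuous f -> continuous g ->
  L (fun x => f x + g x) = L f + L g.
Hypothesis LZ : forall (c : R) (f : T -> R), continuous f ->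
  L (fun x => c * f x) = c * L f.
Hypothesis L_ge0 : forall f : T -> R, continuous f ->
  (forall x, 0 <= f x) -> 0 <= L f.
Hypothesis L1 : L (fun=> 1) = 1.

Let L_le (f g : T -> R) : continuous f -> continuous g ->
  (forall x, f x <= g x) -> L f <= L g.
Proof.
move=> cf cg fg; have cN : continuous (fun x => (-1) * f x).
  by move=> x; apply: cvgM; [exact: cvg_cst|exact: cf].
have := @L_ge0 (fun x => g x + (-1) * f x); rewrite LD// LZ// mulN1r subr_ge0.
by apply => [x|x]; [apply: cvgD; [exact: cg|exact: cN]|
  rewrite mulN1r subr_ge0].
Qed.

Let L_cst c : L (fun=> c) = c.
Proof.
rewrite -[RHS]mulr1 -L1 -LZ; last by move=> x; exact: cvg_cst.
by congr L; apply/funext => x; rewrite mulr1.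
Qed.

Let L_sum n (h : nat -> T -> R) : (forall i, continuous (h i)) ->
  L (fun x => \sum_(i < n) h i x) = \sum_(i < n) L (h i).
Proof. by apply: additive_sumr => //; exact: L_cst. Qed.

(** The intended measure of an open set. [outer] extends it to all sets from outside and is later
    restricted to the Borel sets by Caratheodory's criterion. *)
Let inner (U : set T) : \bar R := ereal_sup [set (L f)%:E | f in bumps U].

Let outer (E : set T) : \bar R :=
  ereal_inf [set inner U | U in [set U | open U /\ E `<=` U]].

Let bump0 (U : set T) : bumps U (fun=> 0 : R).
Proof. by split => // [x|x]; [exact: cvg_cst|rewrite lexx ler01]. Qed.

Let bump_cutoff (U : set T) m : bumps U (cutoff d U m).
Proof.
split; first exact: cutoff_continuous.
- by move=> x; rewrite cutoff_ge0// cutoff_le1.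
- by move=> x Ux; rewrite cutoff_out.
Qed.

Let le_inner (U : set T) f : bumps U f -> ((L f)%:E <= inner U)%E.
Proof. by move=> Uf; apply: ereal_sup_ubound; exists f. Qed.

Let inner_ge0 U : (0 <= inner U)%E.
Proof. by apply: le_trans (le_inner (bump0 U)); rewrite L_cst. Qed.

Let inner_le1 U : (inner U <= 1)%E.
Proof.
apply: ge_ereal_sup => _ [f [cf f01 _] <-].
rewrite lee_fin -L1; apply: L_le => // [x|x]; first exact: cvg_cst.
by have /andP[] := f01 x.
Qed.

Let inner_fin U : inner U \is a fin_num.
Proof.
by rewrite ge0_fin_numE// (le_lt_trans (inner_le1 U))// ltey.
Qed.

Let inner_sub U V : U `<=` V -> (inner U <= inner V)%E.
Proof.
move=> UV; apply: ge_ereal_sup => _ [f [cf f01 f0] <-].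
by apply: le_inner; split => // x Vx; apply: f0 => /UV.
Qed.

Let innerT : inner setT = 1%E.
Proof.
apply/eqP; rewrite eq_le inner_le1 -{1}L1; apply: le_inner.
split => [x|x|x]; [exact: cvg_cst|by rewrite lexx ler01|].
by move/(_ I).
Qed.

(* Dini's argument: the sums of cutoffs increase to at least 1 on the union of
   the [U i], and [f] vanishes elsewhere. *)
Let bump_bigcup (U : (set T)^nat) f (e : R) : 0 < e -> (forall i, open (U i)) ->
  bumps (\bigcup_i U i) f ->
  exists m, forall x, f x <= e + \sum_(i < m) cutoff d (U i) m x.
Proof.
move=> e0 oU [cf f01 f0].
(* The index [m] both counts the sets and sets the steepness of the cutoffs, so [S] grows with it in
   both respects. *)
pose S m x := \sum_(i < m) cutoff d (U i) m x.
have cS m : continuous (S m).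
  apply: (@continuous_sumr _ _ m (fun i => cutoff d (U i) m)) => i.
  exact: cutoff_continuous.
have Smono x m n : (m <= n)%N -> S m x <= S n x.
  move=> mn; rewrite /S -(big_mkord xpredT (fun i => cutoff d (U i) m x)).
  rewrite -(big_mkord xpredT (fun i => cutoff d (U i) n x)).
  rewrite (big_cat_nat _ mn)//= -[leLHS]addr0 lerD//; last first.
    by apply: sumr_ge0 => i _; exact: cutoff_ge0.
  by apply: ler_sum => i _; exact: cutoff_nondecreasing.
have small x : exists m, f x < e + S m x.
  have [[i _ Uix]|Ux] := pselect ((\bigcup_i U i) x); last first.
    by exists 0%N; rewrite f0// /S big_ord0 addr0.
  have [m /= im mx] : exists2 m, (i < m)%N & cutoff d (U i) m x = 1.
    near \oo => m; exists m; near: m; first exact: nbhs_infty_gt.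
    exact: cutoff_near1.
  exists m; have /andP[_ fx1] := f01 x; rewrite (le_lt_trans fx1)//.
  rewrite -[ltLHS]add0r ltr_leD// /S (bigD1 (Ordinal im))//= mx lerDl.
  by apply: sumr_ge0 => j _; exact: cutoff_ge0.
(* The strict inequality at [x] persists on a neighbourhood and, by [Smono], for all larger indices;
   compactness then gives one index for all points. *)
have /compact_near_coveringP := cT.
move=> /(_ nat \oo (fun m x => f x <= e + S m x)); case.
  move=> x _; have [m mx] := small x.
  exists ([set y | f y < e + S m y], [set n | (m <= n)%N]); first split => /=.
  - have cSf : (fun y => e + S m y - f y) @ x --> e + S m x - f x.
      by apply: cvgB (cf x); apply: cvgD (cS m x); exact: cvg_cst.
    have /(cvgr_gt _ cSf) : 0 < e + S m x - f x by rewrite subr_gt0.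
    by apply: filterS => y; rewrite subr_gt0.
  - by exists m.
  - by move=> [y n] /= [/ltW fy mn]; rewrite (le_trans fy)// lerD2l Smono.
by move=> m _ /(_ m (leqnn m)) fm; exists m => x; exact: fm.
Unshelve. all: by end_near. Qed.

(** Apply [L] to the inequality of [bump_bigcup]: only finitely many cutoffs occur, each of them a
    bump of its own [U i]. *)
Let inner_bigcup (U : (set T)^nat) : (forall i, open (U i)) ->
  (inner (\bigcup_i U i) <= \sum_(i <oo) inner (U i))%E.
Proof.
move=> oU; apply: ge_ereal_sup => _ [f Uf <-].
have [cf _ _] := Uf; apply/lee_addgt0Pr => e e0.
have [m fm] := bump_bigcup e0 oU Uf.
pose h i := cutoff d (U i) m.
have ch i : continuous (h i) by exact: cutoff_continuous.
have : L f <= e + \sum_(i < m) L (h i).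
  rewrite -L_sum// -[X in _ <= X + _]L_cst -LD; last 2 first.
  - by move=> x; exact: cvg_cst.
  - exact: continuous_sumr.
  apply: L_le => // x; apply: cvgD; first exact: cvg_cst.
  exact: (continuous_sumr ch).
rewrite -lee_fin => /le_trans; apply.
rewrite EFinD addeC leeD2r// -sumEFin.
apply: le_trans (nneseries_lim_ge m _) => //.
rewrite big_mkord; apply: lee_sum => i _.
exact/le_inner/bump_cutoff.
Qed.

Let outer_open U : open U -> outer U = inner U.
Proof.
move=> oU; apply/eqP; rewrite eq_le; apply/andP; split.
  by apply: ereal_inf_lbound; exists U => //; split.
by apply: le_ereal_inf_tmp => _ [V [_ UV] <-]; exact: inner_sub.
Qed.

Let le_outer_inner E U : open U -> E `<=` U -> (outer E <= inner U)%E.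
Proof. by move=> oU EU; apply: ereal_inf_lbound; exists U. Qed.

Let outer_ge0 E : (0 <= outer E)%E.
Proof. by apply: le_ereal_inf_tmp => _ [V _ <-]. Qed.

Let outer0 : outer set0 = 0%E.
Proof.
rewrite outer_open; last exact: open0.
apply/eqP; rewrite eq_le inner_ge0 andbT.
apply: ge_ereal_sup => _ [f [cf _ f0] <-].
rewrite lee_fin -(L_cst 0) L_le// => [x|x]; first exact: cvg_cst.
by rewrite f0.
Qed.

Let outer_sub : {homo outer : A B / A `<=` B >-> (A <= B)%E}.
Proof.
move=> A B AB; apply: le_ereal_inf_tmp => _ [V [oV BV] <-].
exact/le_outer_inner/(subset_trans AB).
Qed.

Let outer_fin E : outer E \is a fin_num.
Proof.
rewrite ge0_fin_numE// (@le_lt_trans _ _ 1%E) ?ltey//.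
by rewrite -innerT; apply: le_outer_inner => //; exact: openT.
Qed.

Let outer_adherent E e : 0 < e ->
  exists U, [/\ open U, E `<=` U & (inner U <= outer E + e%:E)%E].
Proof.
move=> e0; have [_ [U [oU EU] <-] /ltW ?] :=
  lb_ereal_inf_adherent e0 (outer_fin E).
by exists U.
Qed.

Let outer_sigma : sigma_subadditive outer.
Proof.
move=> F; apply/lee_addgt0Pr => e e0.
(* The slacks [e / 2 ^ i.+1] granted to the open supersets of the [F i] add up to [e]. *)
have e2 n : 0 < e / (2 ^ n.+1)%:R :> R by rewrite divr_gt0// ltr0n expn_gt0.
have /choice[U UF] : forall i, exists U, [/\ open U, F i `<=` U &
    (inner U <= outer (F i) + (e / (2 ^ i.+1)%:R)%:E)%E].
  by move=> i; exact: outer_adherent.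
apply: le_trans (epsilon_trick _ _ (ltW e0)) => //.
apply: (@le_trans _ _ (inner (\bigcup_i U i))).
  apply: le_outer_inner; first by apply: bigcup_open => i _; have [] := UF i.
  by apply: subset_bigcup => i _; have [] := UF i.
apply: (le_trans (inner_bigcup _)); first by move=> i; have [] := UF i.
by apply: lee_nneseries => // i _; have [] := UF i.
Qed.

HB.instance Definition _ := isOuterMeasure.Build R T outer
  outer0 outer_ge0 outer_sub outer_sigma.

(* If [f] lives in [U] and [g] in the complement of [f >= e], then
   [min 1 (f + g)] is a bump that loses at most [e]. *)
Let outer_open_caratheodory U : open U -> outer.-caratheodory U.
Proof.
move=> oU; apply: le_caratheodory_measurable => E.
apply: le_ereal_inf_tmp => _ [V [oV EV] <-].
apply: (@le_trans _ _ (inner (V `&` U) + outer (V `&` ~` U))%E).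
  apply: leeD; last by apply: outer_sub; exact: setSI.
  by apply: le_outer_inner; [exact: openI|exact: setSI].
apply/lee_addgt0Pr => e e0.
rewrite -leeBrDr//; apply: ge_ereal_sup => _ [f [cf f01 f0] <-].
rewrite leeBrDr// addeC -leeBrDr//.
pose O := V `&` f @^-1` [set t | t < e].
apply: (@le_trans _ _ (inner O)).
  apply: le_outer_inner.
    by apply: openI => //; move/continuousP : cf; apply; exact: open_lt.
  by move=> x [Vx Ux]; split => //=; rewrite f0// => -[].
apply: ge_ereal_sup => _ [g [cg g01 g0] <-].
rewrite leeBrDr// -EFinD -leeBlDr// -EFinB.
pose h x := Num.min 1 (f x + g x).
have cfg : continuous (fun x => f x + g x).
  by move=> x; apply: cvgD; [exact: cf|exact: cg].
have ch : continuous h.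
  move=> x; apply: (@continuous_min _ _ (cst 1) (fun x => f x + g x) x).
    exact: cvg_cst.
  exact: cfg.
have Lh : L g + L f <= e + L h.
  rewrite addrC -LD// -[X in _ <= X + _]L_cst -LD//; last first.
    by move=> x; exact: cvg_cst.
  apply: L_le => // x.
    by apply: cvgD; [exact: cvg_cst|exact: ch].
  have /andP[fx0 fx1] := f01 x; have /andP[gx0 gx1] := g01 x.
  rewrite /h; have [fg1|fg1] := leP 1 (f x + g x); last by lra.
  have [Ox|Ox] := pselect (O x); last by rewrite g0//; lra.
  by case: Ox => /= _; lra.
apply: (@le_trans _ _ (L h)%:E); first by rewrite lee_fin; lra.
apply: le_inner; split => // x; last first.
  by move=> Vx; rewrite /h f0 ?g0 ?addr0; [exact/min_idPr|case|case].
have /andP[fx0 fx1] := f01 x; have /andP[gx0 gx1] := g01 x.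
by rewrite /h le_min ge_min lexx ler01 addr_ge0.
Qed.

(** The Caratheodory sets form a sigma-algebra, so it is enough that it contains the open sets. *)
Let borel_caratheodory (A : set (borel T)) : measurable A ->
  outer.-caratheodory A.
Proof.
move: A; apply: smallest_sub; last exact: outer_open_caratheodory.
exact: (@sigma_algebra_measurable _ (caratheodory_type outer)).
Qed.

(** The same set function, retyped on [borel T] so that the measure structure is attached to the
    Borel sigma-algebra. *)
Let rho : set (borel T) -> \bar R := outer.

Let rho_sigma : semi_sigma_additive rho.
Proof.
move=> F mF tF mUF.
apply: (@caratheodory_measure_sigma_additive R T outer) => //.
- by move=> i; exact: borel_caratheodory.
- exact: borel_caratheodory.
Qed.

HB.instance Definition _ := isMeasure.Build _ (borel T) R rho
  outer0 outer_ge0 rho_sigma.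

Let rhoT : rho setT = 1%E.
Proof. by rewrite /rho outer_open ?innerT//; exact: openT. Qed.

HB.instance Definition _ := Measure_isProbability.Build _ (borel T) R rho rhoT.


(** Outer regularity is built into [outer]. For inner regularity, take an open set exceeding the
    complement of [A] by at most [e]: its complement is closed, hence compact, lies in [A], and
    misses at most [e] of its measure. *)
Let rho_regular : regular_measure rho.
Proof.
move=> A mA; split.
  congr ereal_inf; apply/seteqP; split => _ [U [oU AU] <-];
    by exists U => //; rewrite /rho outer_open.
apply/eqP; rewrite eq_le; apply/andP; split; last first.
  by apply: ge_ereal_sup => _ [K [_ KA] <-]; exact: outer_sub.
apply/lee_addgt0Pr => e e0.
have [V [oV AV Ve]] := outer_adherent (~` A) e0.
have mV : measurable (V : set (borel T)) by exact: sub_sigma_algebra.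
apply: (@le_trans _ _ (rho (~` V) + e%:E)%E); last first.
  rewrite leeD2r//; apply: ereal_sup_ubound; exists (~` V) => //; split.
    by apply: (subclosed_compact _ cT) => //; exact: open_closedC.
  by move=> x Vx; apply: contrapT => /AV.
have := Ve; rewrite -outer_open// -[outer]/rho.
have -> : rho (~` V) = (1 - rho V)%E by exact: probability_setC.
have -> : rho (~` A) = (1 - rho A)%E by exact: probability_setC.
have /fineK <- : rho V \is a fin_num by exact: outer_fin.
have /fineK <- : rho A \is a fin_num by exact: outer_fin.
by rewrite -EFinB -!EFinD !lee_fin; lra.
Qed.

Let I f := \int[rho]_x f x.

(* Layer cake: [f] is cut into [n.+1] horizontal slices of height [N^-1], and
   the slice above level [j] dominates [N^-1] times any bump of [U j.+1]. *)
Let I_slices (f : T -> R) n : continuous f -> (forall x, 0 <= f x <= 1) ->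
  I f <= L f + n.+1%:R^-1.
Proof.
move=> cf f01; pose N : R := n.+1%:R; have N0 : 0 < N by rewrite ltr0n.
pose g j x := Num.min (f x) (j.+1%:R / N) - Num.min (f x) (j%:R / N).
pose U j := [set x | j%:R / N < f x].
have cmin c : continuous (fun x => Num.min (f x) c).
  move=> x; apply: (@continuous_min _ _ f (cst c) x); first exact: cf.
  exact: cvg_cst.
have cg j : continuous (g j).
  by move=> x; apply: cvgB; exact: cmin.
have oU j : open (U j).
  move/continuousP : cf => /(_ [set t | j%:R / N < t]); apply.
  exact: open_gt.
have mU j : measurable (U j : set (borel T)) by exact: sub_sigma_algebra.
have fE : f = (fun x => \sum_(j < n.+1) g j x).
  apply/funext => x; have /andP[fx0 fx1] := f01 x.
  rewrite -(big_mkord xpredT (fun j => g j x)) /g.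
  rewrite (telescope_sumr (fun j => Num.min (f x) (j%:R / N)))//.
  rewrite mul0r (min_idPr fx0) subr0 divff ?gt_eqF//.
  by rewrite (min_idPl fx1).
have jN j : j.+1%:R / N = j%:R / N + N^-1 by rewrite -natr1 mulrDl mul1r.
have Ni0 : 0 < N^-1 by rewrite invr_gt0.
have gP j x := slice_bounds (f x) (j%:R / N) (ltW Ni0).
have {}gP j x : [/\ 0 <= g j x <= N^-1, f x <= j%:R / N -> g j x = 0 &
  j%:R / N + N^-1 <= f x -> g j x = N^-1] by rewrite /g jN; exact: gP.
pose m j := fine (rho (U j)).
have mE j : (m j)%:E = rho (U j) by rewrite fineK// outer_fin.
(* The slice [g j] is at most [N^-1] and vanishes off [U j]. The lower bound [Lg] uses the next
   level [U j.+1], where the slice is full. *)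
have Ig j : I (g j) <= N^-1 * m j.
  have -> : N^-1 * m j = \int[rho]_x (N^-1 * \1_(U j) x).
    rewrite RintegralZl//; last exact: integrable_indic.
    by rewrite /Rintegral integral_indic// setIT.
  apply: le_Rintegral => //.
  - exact: continuous_integrable.
  - have := integrable_indic rho (mU j).
    by move/(integrableZl measurableT N^-1).
  move=> x _; rewrite indicE; have [/andP[_ gN] g0 _] := gP j x.
  have [Ux|/negP Ux] := boolP (x \in U j); first by rewrite mulr1.
  rewrite mulr0 g0// leNgt; apply/negP => ?; apply: Ux; exact/mem_set.
have Lg j : N^-1 * m j.+1 <= L (g j).
  rewrite mulrC ler_pdivrMr// mulrC -lee_fin mE /rho outer_open//.
  apply: ge_ereal_sup => _ [h [ch h01 h0] <-].
  rewrite lee_fin -LZ//; apply: L_le => // x.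
    by apply: cvgM; [exact: cvg_cst|exact: cg].
  have /andP[h0x h1x] := h01 x; have [/andP[g0 _] _ gN] := gP j x.
  have [Ux|/= Ux] := pselect (U j.+1 x); last by rewrite h0// mulr_ge0// ltW.
  by rewrite gN ?divff ?gt_eqF// -jN ltW.
have m01 j : 0 <= m j <= 1.
  by rewrite -!lee_fin mE outer_ge0/= probability_le1.
rewrite {1}fE {1}/I additive_sumr//; last 2 first.
- exact: continuous_RintegralD.
- exact: probability_Rintegral_cst.
rewrite [in leRHS]fE L_sum//.
apply: (@le_trans _ _ (N^-1 * \sum_(j < n.+1) m j)).
  by rewrite mulr_sumr; apply: ler_sum => j _; exact: Ig.
apply: (@le_trans _ _ (\sum_(j < n.+1) N^-1 * m j.+1 + N^-1)); last first.
  by rewrite lerD2r; apply: ler_sum => j _; exact: Lg.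
rewrite -mulr_sumr -[X in _ <= _ + X]mulr1 -mulrDr ler_pM2l//.
(* The two sums are shifted by one index, so they differ by [m 0 - m n.+1], which is at most 1. *)
have : \sum_(j < n.+2) m j = m 0%N + \sum_(j < n.+1) m j.+1.
  by rewrite big_ord_recl.
rewrite big_ord_recr/=.
by have /andP[? _] := m01 n.+1; have /andP[_ ?] := m01 0%N => ?; lra.
Qed.

(** For values in [0, 1] the error in [I_slices] tends to 0. A function bounded by [k] is moved
    there by the affine map [(f + k) / (2 k)], with which [I] and [L] both commute since they agree
    on constants. *)
Let I_le (f : T -> R) : continuous f -> I f <= L f.
Proof.
wlog f01 : f / forall x, 0 <= f x <= 1 => [hw cf|cf]; last first.
  apply/ler_addgt0Pr => e e0; near \oo => n.
  apply: (le_trans (I_slices n cf f01)); rewrite lerD2l.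
  by apply: ltW; near: n; exact: (near_infty_natSinv_lt (PosNum e0)).
have [k k_gt0 fk] : exists2 k, 0 < k & forall x, `|f x| <= k.
  have [k0 fk0] := compact_bounded_fun cT cf.
  exists (`|k0| + 1) => [|x]; first by rewrite ltr_wpDl.
  by rewrite (le_trans (fk0 x))// (le_trans (ler_norm k0))// lerDl.
have ck : continuous (fun _ : T => k) by move=> x; exact: cvg_cst.
have cfk : continuous (fun x => f x + k).
  by move=> x; apply: cvgD; [exact: cf|exact: ck].
have := hw (fun x => (k + k)^-1 * (f x + k)).
rewrite /I continuous_RintegralZ// LZ// ler_pM2l ?invr_gt0 ?addr_gt0//.
rewrite continuous_RintegralD// LD// probability_Rintegral_cst L_cst lerD2r.
apply => [x|x]; last by apply: cvgM; [exact: cvg_cst|exact: cfk].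
have := fk x; rewrite ler_norml => /andP[fxk xk].
apply/andP; split; last by rewrite mulrC ler_pdivrMr ?addr_gt0//; lra.
by apply: mulr_ge0; [rewrite invr_ge0; lra|lra].
Unshelve. all: by end_near. Qed.

(** One inequality is enough: [I_le] applied to [- f] is the reverse inequality for [f]. *)
Theorem riesz_representation : exists rho : regular_probability R T,
  forall f : T -> R, continuous f -> \int[rho]_x f x = L f.
Proof.
exists (RegProb rho_regular) => f cf; apply/eqP; rewrite eq_le I_le//=.
have cN : continuous (fun x => (-1) * f x).
  by move=> x; apply: cvgM; [exact: cvg_cst|exact: cf].
by have := I_le cN; rewrite LZ// /I continuous_RintegralZ// !mulN1r lerN2.
Qed.

End riesz.

(** * Weak limits, and equality of measures through cutoffs *)

Lemma ultra_compact_cvg {I : Type} {V : ptopologicalType} (F : set_system I)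
    (u : I -> V) (K : set V) : UltraFilter F -> compact K ->
  (forall i, K (u i)) -> cvg (u @ F).
Proof.
move=> FU cK Ku; have uK : (u @ F) K by apply: nearW => i; exact: Ku.
(* Compactness yields a cluster point; an ultrafilter converges to it, since it contains each
   preimage or its complement. *)
have [p [_ up]] := cK (u @ F) _ uK.
apply/cvg_ex; exists p => A Ap.
have [//|AC] := in_ultra_setVsetC (u @^-1` A) FU.
by have [y []] := up (~` A) A AC Ap.
Qed.

Section weak_limits.
Context {R : realType} {T : ptopologicalType} {d : T -> T -> R}.
Hypotheses (dP : metrizes d) (cT : compact [set: T]).

(** A single ultrafilter makes the integrals of all continuous functions converge at once, in place
    of an extraction of subsequences. *)
Lemma weak_ultralimit {I : Type} (F : set_system I)
    (mu : I -> regular_probability R T) : UltraFilter F ->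
  exists rho : regular_probability R T, forall f : T -> R, continuous f ->
    \int[mu i]_x f x @[i --> F] --> \int[rho]_x f x.
Proof.
move=> FU; pose L f := lim (\int[mu i]_x f x @[i --> F]).
have LE f : continuous f -> \int[mu i]_x f x @[i --> F] --> L f.
  move=> cf; have [k fk] := compact_bounded_fun cT cf.
  apply: (ultra_compact_cvg FU (@segment_compact _ (- k) k)) => i /=.
  by rewrite in_itv/= -ler_norml le_norm_continuous_Rintegral.
have limE (u : I -> R) l : u i @[i --> F] --> l -> lim (u @ F) = l.
  by move=> ?; exact/cvg_lim.
have [||||rho rhoL] := @riesz_representation R T d dP cT L.
- move=> f g cf cg; rewrite {1}/L; apply: limE.
  under eq_fun do rewrite continuous_RintegralD//.
  by apply: cvgD; exact: LE.
- move=> c f cf; rewrite {1}/L; apply: limE.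
  under eq_fun do rewrite continuous_RintegralZ//.
  by apply: cvgM; [exact: cvg_cst|exact: LE].
- move=> f cf f0; apply: limr_ge; first exact: (cvgP _ (LE _ cf)).
  by apply: nearW => i; exact: Rintegral_ge0.
- rewrite /L; apply: limE; under eq_fun do rewrite probability_Rintegral_cst.
  exact: cvg_cst.
by exists rho => f cf; rewrite rhoL//; exact: LE.
Qed.

Lemma cvg_Rintegral_cutoff (mu : probability (borel T) R) (U : set T) :
  open U -> (\int[mu]_x (cutoff d U n x)%:E)%E @[n --> \oo] --> mu U.
Proof.
move=> oU; have mU : measurable (U : set (borel T)) by exact: sub_sigma_algebra.
have -> : mu U = (\int[mu]_x limn (fun n => (cutoff d U n x)%:E))%E.
  rewrite -[in LHS](setIT U) -integral_indic//.
  apply: eq_integral => x _; apply/esym/cvg_lim => //.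
  rewrite indicE; have [/set_mem Ux|Ux] := boolP (x \in U).
    apply: cvg_near_cst; apply: filterS (cutoff_near1 dP oU Ux).
    by move=> n ->.
  apply: cvg_near_cst; apply: nearW => n; rewrite cutoff_out//.
  by move=> /mem_set Ux'; rewrite Ux' in Ux.
apply: cvg_monotone_convergence => //.
- move=> n; apply/measurable_EFinP; apply: continuous_measurable_borel.
  exact: (cutoff_continuous dP).
- by move=> n x _; rewrite lee_fin cutoff_ge0.
- by move=> x _ m n mn; rewrite lee_fin cutoff_nondecreasing.
Qed.

(** Open sets are stable under intersection and generate the Borel sets, so agreement on them,
    obtained as the limit of the cutoff integrals, propagates. *)
Lemma eq_Rintegral_cutoff_measure_eq (mu mu' : probability (borel T) R) :
  (forall U n, \int[mu]_x cutoff d U n x = \int[mu']_x cutoff d U n x) ->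
  measure_eq mu mu'.
Proof.
move=> h A mA.
have openE (U : set T) : open U -> mu U = mu' U.
  move=> oU; have ic (m : probability (borel T) R) n :
      (\int[m]_x (cutoff d U n x)%:E)%E = (\int[m]_x cutoff d U n x)%:E.
    rewrite fineK//; apply: integrable_fin_num => //.
    exact/(continuous_integrable _ cT)/(cutoff_continuous dP).
  have := @cvg_Rintegral_cutoff mu' _ oU.
  under eq_fun do rewrite ic -h -ic.
  have := @cvg_Rintegral_cutoff mu _ oU.
  exact: cvg_unique.
apply: (@g_sigma_algebra_measure_unique _ R (borel T) (@open T) _ (fun=> setT)).
- by move=> U oU; exact: sub_sigma_algebra.
- by move=> _; exact: openT.
- by apply/seteqP; split => // x _; exists 0%N.
- by move=> U V; exact: openI.
- exact: openE.
- by move=> _; rewrite -ge0_fin_numE//; exact: fin_num_measure.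
- exact: mA.
Qed.

End weak_limits.

(** * Least Lipschitz constants *)

Section lipschitz_const.
Context {R : realType} {A B : Type} {dA : A -> A -> R} {dB : B -> B -> R}.
Hypothesis dA_ge0 : forall x y, 0 <= dA x y.

Lemma lipschitz_const_le (f : A -> B) k :
  lipschitz_bounds dA dB f k -> lipschitz_const dA dB f <= k.
Proof. by move=> fk; apply: ge_inf => //; exists 0 => ? []. Qed.

Lemma lipschitz_const_ge0 (f : A -> B) :
  is_lipschitz dA dB f -> 0 <= lipschitz_const dA dB f.
Proof. by move=> lf; apply: lb_le_inf => // k []. Qed.

(** The infimum is itself admissible: divide by [dA x y] when it is positive; when it is 0, any
    admissible constant already bounds [dB] by 0. *)
Lemma lipschitz_constP (f : A -> B) : is_lipschitz dA dB f ->
  forall x y, dB (f x) (f y) <= lipschitz_const dA dB f * dA x y.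
Proof.
move=> lf x y; have [k0 [_ fk0]] := lf.
have [d0|d0] := eqVneq (dA x y) 0; first by have := fk0 x y; rewrite d0 !mulr0.
have {}d0 : 0 < dA x y by rewrite lt_def d0 dA_ge0.
rewrite -ler_pdivrMr//; apply: lb_le_inf => // k [_ fk].
by rewrite ler_pdivrMr.
Qed.

End lipschitz_const.

(** * Topology of a nonempty subset *)

Section subspace.
Context {T : topologicalType} {A : set T} {A0 : A !=set0}.

(* Instance resolution does not unfold [subspace_type]. *)
#[global] Instance subspace_type_nbhs_filter (x : subspace_type A0) :
  ProperFilter (nbhs x).
Proof. exact: nbhs_pfilter. Qed.

Lemma subspace_val_continuous :
  continuous (val : subspace_type A0 -> T).
Proof. exact: initial_continuous. Qed.

Lemma nbhs_subspace_type (x : subspace_type A0) (U : set (subspace_type A0)) :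
  nbhs x U <-> exists2 V, nbhs (val x) V & forall y, V (val y) -> U y.
Proof.
split=> [|[V xV VU]].
  move=> [_ /= [[V oV <-] Vx VU]]; exists V; last exact: VU.
  exact: open_nbhs_nbhs.
by apply: filterS VU _; exact: subspace_val_continuous.
Qed.

(** The image filter under [val] has a cluster point in [A], which is then a cluster point of the
    original filter. *)
Lemma compact_subspace_type : compact A -> compact [set: subspace_type A0].
Proof.
move=> cA F FF _; have FA : (val @ F) A.
  by apply: nearW => x; exact: set_valP.
have [p [Ap pF]] := cA (val @ F) _ FA.
exists (SigSub (mem_set Ap)); split => // B C FB /nbhs_subspace_type[V pV VC].
have FvB : F (val @^-1` (val @` B)) by apply: filterS FB => b Bb; exists b.
by have [_ [[b Bb <-] Vb]] := pF (val @` B) V FvB pV;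
  exists b; split => //; exact: VC.
Qed.

End subspace.

(** * The distance between probability measures on the attractor *)

Section transport_distance.
Context {R : realType} {X : metricType R} {W : set X} {W0 : W !=set0}.
Hypothesis cW : compact W.
Notation T := (subspace_type W0).
Implicit Types mu : prob_on R W0.

Lemma mdist_on_metrizes : metrizes (mdist_on : T -> T -> R).
Proof.
split=> [x|x y|x y z|x U].
- exact: mdistxx.
- exact: metric_sym.
- exact: metric_triangle.
rewrite nbhs_subspace_type; split=> [[V xV VU]|[e e0 eU]].
  move: xV; rewrite -filter_from_ballE => -[e e0 eV]; exists e => // y xy.
  by apply/VU/eV; rewrite ballEmdist.
exists (ball (val x) e); first exact: nbhsx_ballx.
by move=> y; rewrite ballEmdist; exact: eU.
Qed.

Let cT : compact [set: T] := compact_subspace_type cW.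

Lemma mdist_on_ge0 (x y : W) : 0 <= mdist_on x y.
Proof. exact: mdist_ge0. Qed.

Lemma lip1P (phi : W -> R) :
  lip1 phi <-> forall x y, `|phi x - phi y| <= mdist_on x y.
Proof.
split=> [[lphi phi1] x y|h].
  apply: (le_trans (lipschitz_constP mdist_on_ge0 lphi x y)).
  by rewrite ler_piMl// mdist_on_ge0.
have b1 : lipschitz_bounds mdist_on (fun s t : R => `|s - t|) phi 1.
  by split => // x y; rewrite mul1r.
by split; [exists 1|exact: lipschitz_const_le].
Qed.

Lemma lip_continuous (k : R) (phi : T -> R) :
  (forall x y, `|phi x - phi y| <= k * mdist_on x y) -> continuous phi.
Proof. by move=> h; apply: lipschitz_continuous mdist_on_metrizes _ _ h. Qed.

Lemma lip1_continuous (phi : T -> R) : lip1 phi -> continuous phi.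
Proof.
by move=> /lip1P h; apply: (@lip_continuous 1) => x y; rewrite mul1r.
Qed.

(** Ensures that the supremum in [Ldist] is over a bounded set. Subtracting the constant [phi w0]
    does not change the difference of two probability integrals, and what remains is bounded by the
    largest distance to [w0]. *)
Lemma lip1_Rintegral_bounded : exists M, forall mu mu' (phi : T -> R),
  lip1 phi -> `|\int[mu]_w phi w - \int[mu']_w phi w| <= M.
Proof.
pose w0 : T := point.
have cd : continuous (mdist_on w0 : T -> R).
  apply: (@lip_continuous 1) => x y; rewrite mul1r ler_distl.
  have h1 := metrizes_triangle mdist_on_metrizes w0 x y.
  have h2 := metrizes_triangle mdist_on_metrizes w0 y x.
  rewrite (metrizes_sym mdist_on_metrizes y x) in h2.
  by apply/andP; split; lra.
have [D hD] := compact_bounded_fun cT cd.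
exists (D + D) => mu mu' phi /[dup] /lip1_continuous cphi /lip1P phi1.
have cc : continuous (fun _ : T => phi w0).
  by apply: (@lip_continuous 1) => x y; rewrite subrr normr0 mul1r mdist_on_ge0.
pose psi w := phi w - phi w0.
have cpsi : continuous psi.
  by apply: (@lip_continuous 1) => x y; rewrite mul1r /psi opprB addrA subrK.
have E m : \int[prob_of m]_w phi w = \int[prob_of m]_w psi w + phi w0.
  rewrite continuous_RintegralB// probability_Rintegral_cst.
  by rewrite subrK.
rewrite !E opprD addrACA subrr addr0 (le_trans (ler_normB _ _))//.
rewrite lerD//; apply: le_norm_continuous_Rintegral => // x;
  by rewrite /psi distrC (le_trans (phi1 _ _))// (le_trans _ (hD x))// ler_norm.
Qed.

Let Lset mu mu' :=
  [set `|\int[mu]_w phi w - \int[mu']_w phi w| | phi in @lip1 R X W].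

Let Lset_neq0 mu mu' : Lset mu mu' !=set0.
Proof.
exists `|\int[mu]_w (0 : R) - \int[mu']_w (0 : R)|; exists (fun=> 0) => //.
by apply/lip1P => x y; rewrite subrr normr0 mdist_on_ge0.
Qed.

Lemma Ldist_bounded : exists M, forall mu mu', Ldist mu mu' <= M.
Proof.
have [M hM] := lip1_Rintegral_bounded; exists M => mu mu'.
by apply: ge_sup; [exact: Lset_neq0|move=> _ [phi lphi <-]; exact: hM].
Qed.

Lemma Ldist_le mu mu' c : (forall phi : T -> R, lip1 phi ->
  `|\int[mu]_w phi w - \int[mu']_w phi w| <= c) -> Ldist mu mu' <= c.
Proof.
move=> h; apply: ge_sup; first exact: Lset_neq0.
by move=> _ [phi lphi <-]; exact: h.
Qed.

Lemma lip1_le_Ldist mu mu' (phi : T -> R) : lip1 phi ->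
  `|\int[mu]_w phi w - \int[mu']_w phi w| <= Ldist mu mu'.
Proof.
have [M hM] := lip1_Rintegral_bounded.
move=> lphi; apply: ub_le_sup; last by exists phi.
by exists M => _ [psi lpsi <-]; exact: hM.
Qed.

Lemma Ldist_ge0 mu mu' : 0 <= Ldist mu mu'.
Proof.
apply: (@le_trans _ _ `|\int[mu]_w (0 : R) - \int[mu']_w (0 : R)|) => //.
apply: (@lip1_le_Ldist _ _ (fun=> 0)).
by apply/lip1P => x y; rewrite subrr normr0 mdist_on_ge0.
Qed.

(** Dividing by [k] gives a 1-Lipschitz function; for [k = 0] the function is constant and the two
    integrals agree. *)
Lemma lip_le_Ldist mu mu' (k : R) (phi : T -> R) : 0 <= k ->
  (forall x y, `|phi x - phi y| <= k * mdist_on x y) ->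
  `|\int[mu]_w phi w - \int[mu']_w phi w| <= k * Ldist mu mu'.
Proof.
rewrite le_eqVlt => /predU1P[<-|k0] lphi.
  have -> : phi = fun=> phi point.
    apply/funext => x; apply/eqP; rewrite -subr_eq0 -normr_le0.
    by rewrite (le_trans (lphi _ _))// mul0r.
  by rewrite !probability_Rintegral_cst subrr normr0 mul0r.
have cphi := lip_continuous lphi.
have /(@lip1_le_Ldist mu mu') : lip1 (fun w => k^-1 * phi w).
  apply/lip1P => x y; rewrite -mulrBr normrM gtr0_norm ?invr_gt0//.
  by rewrite mulrC ler_pdivrMr// mulrC.
rewrite !continuous_RintegralZ// -mulrBr normrM gtr0_norm ?invr_gt0//.
by rewrite mulrC ler_pdivrMr// mulrC.
Qed.

Lemma Ldist_triangle mu1 mu2 mu3 :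
  Ldist mu1 mu3 <= Ldist mu1 mu2 + Ldist mu2 mu3.
Proof.
apply: Ldist_le => phi lphi.
apply: le_trans (ler_distD (\int[mu2]_w phi w) _ _) _.
by apply: lerD; exact: lip1_le_Ldist.
Qed.

Lemma Ldist_sym mu mu' : Ldist mu mu' = Ldist mu' mu.
Proof.
by apply/eqP; rewrite eq_le; apply/andP; split; apply: Ldist_le => phi lphi;
  rewrite distrC; exact: lip1_le_Ldist.
Qed.

(** Each [cutoff U n] is [n]-Lipschitz, so distance 0 forces all cutoff integrals to agree. *)
Lemma Ldist_eq0 mu mu' : Ldist mu mu' <= 0 -> measure_eq mu mu'.
Proof.
move=> L0; apply: (eq_Rintegral_cutoff_measure_eq mdist_on_metrizes cT) => U n.
apply/eqP; rewrite -subr_eq0 -normr_le0.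
apply: (@le_trans _ _ (n%:R * Ldist mu mu')).
  by apply: lip_le_Ldist => //; exact: (cutoff_lipschitz mdist_on_metrizes).
by rewrite mulr_ge0_le0.
Qed.

Lemma measure_eq_Rintegral mu mu' (phi : T -> R) : measure_eq mu mu' ->
  \int[mu]_w phi w = \int[mu']_w phi w.
Proof.
by move=> h; congr fine; apply: eq_measure_integral => A mA _; exact: h.
Qed.

End transport_distance.

(** * The averaging operator and its fixed point *)

Section averaging_operator.
Context {R : realType} {X : metricType R}.
Context {F : set (continuousType X X)} {W : set X}.
Hypotheses (cX : compact [set: X]).
Variables (hF : compact_IFS F) (hW : is_attractor F W).
Variable nu : prob_on R (compact_IFS_neq0 hF).
Notation TW := (subspace_type (attractor_neq0 hW)).
Notation TF := (subspace_type (compact_IFS_neq0 hF)).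
Notation P_W := (prob_on R (attractor_neq0 hW)).
Implicit Types mu : P_W.

Let cW : compact W. Proof. by case: hW. Qed.

Let cTW : compact [set: TW] := compact_subspace_type cW.

Let cTF : compact [set: TF].
Proof. by apply: compact_subspace_type; case: hF. Qed.

(** Evaluation is jointly continuous for the compact-open topology when the source is locally
    compact and regular, which holds for the compact metric space [X]. *)
Lemma attractor_map_continuous :
  continuous (fun fw : TF * TW => attractor_map hW fw.1 fw.2 : TW).
Proof.
move=> [f w] U /nbhs_subspace_type[V xV VU].
have := @eval_continuous X X _ _ (val f, val w) V xV.
case.
- move=> x _; exists setT; first by rewrite withinET; exact: filterT.
  by split => //; exact: closedT.
- move=> x; apply: (@compact_regular _ x setT) => //.
  + exact: metric_hausdorff.
  + exact: filterT.
move=> [A B] /= [fA wB] ABV.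
exists (val @^-1` A, val @^-1` B); first split => /=.
- by apply/nbhs_subspace_type; exists A.
- by apply/nbhs_subspace_type; exists B.
by move=> [g v] /= [Ag Bv]; apply: VU; exact: (ABV (val g, val v)).
Qed.

(** Near [(f, w)] the values at [(f, v)] and [(g, v)] are both within [e / 2] of the value at
    [(f, w)]; compactness of [W] then gives one neighbourhood of [f] for all points. *)
Lemma attractor_map_equicontinuous (phi : TW -> R) (f : TF) (e : R) :
  continuous phi -> 0 < e -> \forall g \near f, forall w,
    `|phi (attractor_map hW f w) - phi (attractor_map hW g w)| < e.
Proof.
move=> cphi e0.
suff : \forall g \near f, [set: TW] `<=` [set w |
    `|phi (attractor_map hW f w) - phi (attractor_map hW g w)| < e].
  by move=> h; apply: filterS h => g hg w; exact: (hg w I).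
have /compact_near_coveringP/(_ TF (nbhs f)) := cTW; apply => w _.
have cc : continuous (fun gw : TF * TW => phi (attractor_map hW gw.1 gw.2)).
  move=> gw; apply: continuous_comp; first exact: attractor_map_continuous.
  exact: cphi.
have e2 : 0 < e / 2 by rewrite divr_gt0.
have /cvgrPdist_lt/(_ _ e2)[[A B] /= [fA wB] ABe] := cc (f, w).
exists (B, A) => // -[v g] /= [Bv Ag].
have := ABe (f, v) (conj (nbhs_singleton fA) Bv).
have := ABe (g, v) (conj Ag Bv) => /=.
rewrite !ltr_norml => /andP[? ?] /andP[? ?].
by apply/andP; split; lra.
Qed.

Lemma attractor_map_continuousl (f : F) :
  continuous (attractor_map hW f : TW -> TW).
Proof.
move=> w U /(attractor_map_continuous (x := (f : TF, w)))[[A B] /= [fA wB] ABU].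
apply: filterS wB => v Bv; exact: (ABU (f, v) (conj (nbhs_singleton fA) Bv)).
Qed.

Lemma continuous_phi_attractor_map (phi : TW -> R) (f : F) : continuous phi ->
  continuous (fun w : TW => phi (attractor_map hW f w) : R).
Proof.
move=> cphi w; apply: continuous_comp; last exact: cphi.
exact: attractor_map_continuousl.
Qed.

(** Makes the inner integral integrable against [nu]: maps close to [f] give uniformly close
    integrands. *)
Lemma push_integral_continuous mu (phi : TW -> R) : continuous phi ->
  continuous (fun f : TF => \int[mu]_w phi (attractor_map hW f w)).
Proof.
move=> cphi f; apply/cvgrPdist_le => e e0.
apply: filterS (attractor_map_equicontinuous f cphi e0) => g fg.
have cf h := @continuous_phi_attractor_map phi h cphi.
rewrite -continuous_RintegralB//.
apply: le_norm_continuous_Rintegral => // [w|w]; last exact: ltW.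
by apply: cvgB; exact: cf.
Qed.

Lemma average_exists mu : exists m : P_W, is_average nu mu m.
Proof.
pose J phi f := \int[mu]_w phi (attractor_map hW f w).
have cJ phi : continuous phi -> continuous (J phi : TF -> R).
  exact: push_integral_continuous.
have cf phi f : continuous phi ->
    continuous (fun w : TW => phi (attractor_map hW f w) : R).
  exact: continuous_phi_attractor_map.
pose L (phi : TW -> R) := \int[nu]_f J phi f.
have [||||m mL] := @riesz_representation R TW _ mdist_on_metrizes cTW L.
- move=> f g cf' cg; rewrite /L -continuous_RintegralD//; do ?exact: cJ.
  by apply: eq_Rintegral => h _; rewrite /J continuous_RintegralD//; exact: cf.
- move=> c f cf'; rewrite /L -continuous_RintegralZ//; last exact: cJ.
  by apply: eq_Rintegral => h _; rewrite /J continuous_RintegralZ//; exact: cf.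
- move=> f _ f0; apply: Rintegral_ge0 => h _; exact: Rintegral_ge0.
- rewrite /L /J -[RHS](probability_Rintegral_cst nu).
  by apply: eq_Rintegral => h _; exact: probability_Rintegral_cst.
by exists m => phi cphi; exact: mL.
Qed.

Lemma averagingP mu : is_average nu mu (averaging nu mu).
Proof. exact: xgetPex (average_exists mu). Qed.

Lemma attractor_map_lipschitz (f : F) (w v : W) :
  mdist_on (attractor_map hW f w) (attractor_map hW f v) <=
    lipschitz_const mdist mdist (val f) * mdist_on w v.
Proof.
have lf : is_lipschitz mdist mdist (val f : X -> X).
  by case: hF => _ _ + _; apply; exact: set_valP.
exact: (lipschitz_constP (@mdist_ge0 R X) lf (val w) (val v)).
Qed.

Let r : R := sup [set lipschitz_const mdist mdist f | f in F].

Lemma IFS_const_le (f : F) : lipschitz_const mdist mdist (val f) <= r.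
Proof.
have [_ _ _ [r' _ hr']] := hF.
apply: ub_le_sup; last by exists (val f) => //; exact: set_valP.
by exists r' => _ [g Fg <-]; exact: hr'.
Qed.

Lemma IFS_const_lt1 : r < 1.
Proof.
have [[f Ff] _ _ [r' r'1 hr']] := hF.
apply: le_lt_trans r'1; apply: ge_sup.
  by exists (lipschitz_const mdist mdist f); exists f.
by move=> _ [g Fg <-]; exact: hr'.
Qed.

Lemma IFS_const_ge0 : 0 <= r.
Proof.
have [[f Ff] _ lF _] := hF.
apply: le_trans (IFS_const_le (SigSub (mem_set Ff))) => /=.
by apply: lipschitz_const_ge0; exact: lF.
Qed.

Lemma Ldist_averaging mu mu' :
  Ldist (averaging nu mu) (averaging nu mu') <= r * Ldist mu mu'.
Proof.
apply: Ldist_le => phi lphi.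
have cphi := lip1_continuous lphi.
rewrite !averagingP// -continuous_RintegralB//;
  do ?exact: push_integral_continuous.
(* A bound on the inner difference that is uniform in [f] survives integration against the
   probability [nu]. *)
apply: le_norm_continuous_Rintegral => // [|f].
  by move=> f; apply: cvgB; exact: push_integral_continuous.
apply: (lip_le_Ldist cW) IFS_const_ge0 _ => x y.
apply: le_trans (proj1 (lip1P _) lphi _ _) _.
apply: le_trans (attractor_map_lipschitz f x y) _.
by rewrite ler_wpM2r ?mdist_on_ge0// IFS_const_le.
Qed.

Lemma Ldist_iter_averaging n mu mu' :
  Ldist (iter n (averaging nu) mu) (iter n (averaging nu) mu') <=
    r ^+ n * Ldist mu mu'.
Proof.
elim: n => [|n ih]; first by rewrite expr0 mul1r.
rewrite exprS -mulrA /=; apply: le_trans (Ldist_averaging _ _) _.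
by rewrite ler_wpM2l// IFS_const_ge0.
Qed.

(* A fixed point is the limit of the iterates [mu n] along an ultrafilter;
   the estimate [Ldist (mu n) (mu (n + k)) <= r ^+ n * M] passes to that limit
   for each 1-Lipschitz test function. *)
Lemma averaging_fixpoint :
  exists rho : P_W, Ldist rho (averaging nu rho) <= 0.
Proof.
have [U [UU leU]] := ultraFilterLemma (@eventually_filter).
(* The iteration starts from the Dirac measure at [point], obtained by representing the evaluation
   functional. *)
have [mu0 _] : exists mu0 : P_W, True.
  have [//|//|f _ f0|//|m _] := @riesz_representation R TW _
    mdist_on_metrizes cTW (fun phi => phi point); first exact: f0.
  by exists m.
pose mu n := iter n (averaging nu) mu0.
have [rho rhoP] := weak_ultralimit mdist_on_metrizes cTW mu UU.
have [M hM] := Ldist_bounded (W0 := attractor_neq0 hW) cW.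
have muE n k : Ldist (mu n) (mu (n + k)%N) <= r ^+ n * M.
  rewrite /mu iterD; apply: le_trans (Ldist_iter_averaging _ _ _) _.
  by rewrite ler_wpM2l// exprn_ge0// IFS_const_ge0.
have mu_rho n : Ldist (mu n) rho <= r ^+ n * M.
  apply: Ldist_le => phi lphi.
  have cphi := lip1_continuous lphi.
  have c : `|\int[mu n]_w phi w - \int[mu k]_w phi w| @[k --> U] -->
      `|\int[mu n]_w phi w - \int[rho]_w phi w|.
    by apply: cvg_norm; apply: cvgB; [exact: cvg_cst|exact: rhoP].
  apply: (cvgr_to_le c).
  have : U [set k | (n <= k)%N] by apply: leU; exists n.
  apply: filterS => k /= nk; rewrite -(subnKC nk).
  by apply: le_trans (lip1_le_Ldist cW _ _ lphi) (muE _ _).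
exists rho; apply/ler_addgt0Pr => e e0; rewrite add0r.
(* One [M] pays for the way from [rho] to [mu n.+1], the other for the way from there to the average
   of [rho]. *)
have rn : (fun n => r ^+ n * (M + M)) @ \oo --> 0.
  rewrite -[0](mul0r (M + M)); apply: cvgM; last exact: cvg_cst.
  by apply: cvg_expr; rewrite ger0_norm ?IFS_const_ge0// IFS_const_lt1.
have [n _ hn] := cvgr_lt _ rn _ e0.
apply: le_trans (ltW (hn n.+1 (leqnSn n))).
apply: le_trans (Ldist_triangle cW rho (mu n.+1) _) _.
rewrite mulrDr; apply: lerD; first by rewrite (Ldist_sym cW).
apply: le_trans (Ldist_averaging _ _) _.
by rewrite exprS -mulrA ler_wpM2l// IFS_const_ge0.
Qed.

End averaging_operator.

Theorem proposition2p4 (R : realType) (X : metricType R)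
    (F : set (continuousType X X)) (W : set X)
    (X0 : [set: X] !=set0) (cX : compact [set: X])
    (hF : compact_IFS F) (hW : is_attractor F W)
    (nu : prob_on R (compact_IFS_neq0 hF)) :
  let r : R :=
    sup [set lipschitz_const mdist mdist f | f in F] in
  let P_W := prob_on R (attractor_neq0 hW) in
  [/\ r < 1,
      forall mu : P_W, is_average nu mu (averaging nu mu),
      is_contractive Ldist (averaging nu : P_W -> P_W),
      lipschitz_const Ldist Ldist (averaging nu : P_W -> P_W) <= r &
      exists rho : P_W, measure_eq rho (averaging nu rho) /\
        forall rho' : P_W,
          measure_eq rho' (averaging nu rho') -> measure_eq rho' rho].
Proof.
move=> r P_W.
have [_ cW _] := hW.
have r_bound : lipschitz_bounds Ldist Ldist (averaging nu : P_W -> P_W) r.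
  by split; [exact: IFS_const_ge0|exact: Ldist_averaging].
have r_le := lipschitz_const_le r_bound.
split => //.
- exact: IFS_const_lt1.
- exact: averagingP.
- by split; [exists r|exact: le_lt_trans r_le (IFS_const_lt1 hF)].
have [rho rhoE] := averaging_fixpoint cX hW nu.
exists rho; split => [|rho' rho'E]; first exact: Ldist_eq0.
apply: (Ldist_eq0 cW).
have := Ldist_averaging cX nu rho' rho.
(* The fixed-point equations hold only up to [measure_eq], so they are used inside the integrals
   defining [Ldist]. *)
have -> : Ldist (averaging nu rho') (averaging nu rho) = Ldist rho' rho.
  have rho_eq := Ldist_eq0 cW rhoE.
  congr sup; apply/seteqP; split => _ [phi lphi <-]; exists phi => //;
    by rewrite (measure_eq_Rintegral _ rho'E) (measure_eq_Rintegral _ rho_eq).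
(* A nonnegative distance that is at most [r < 1] times itself must be 0. *)
have := Ldist_ge0 cW rho' rho; have := IFS_const_lt1 hF; rewrite -/r.
by move=> r1 L0 Lr; nra.
Qed.
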